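(* Let $\mathcal{P}_4$ be the family of planar graphs having girth at least $4$. The nimber of the game $BS_2(\mathcal{P}_4 : p, q)$ is $0$ for all integers $p, q \geq 3$.
   Context: The girth of a graph is the length of a shortest cycle (infinite if there is no cycle); a pair of parallel edges counts as a cycle of length 2. The game $BS_2(\mathcal{P}_4:p,q)$ ($2$-Brussels sprout for $\mathcal{P}_4$) is the following two-player game, drawn in the plane. Initially there are two spots (vertices), having $p$ and $q$ open tips (short free partial edges) coming out of them, respectively. The players move alternately. A valid move consists of joining two distinct open tips by a curve that crosses neither itself nor any previously drawn curve, and then drawing a crossbar on this curve: the intersection of the crossbar with the curve is a new vertex, which has two new open tips, one on each side of the curve. The two joined tips are no longer open. The associated graph has as vertices the spots and the curve/crossbar intersections, and as edges the curve pieces joining two such vertices (so each move adds one vertex and two edges); it must belong to $\mathcal{P}_4$ at all times. The first player unable to make a valid move loses. The nimber of a finite impartial game is defined recursively: positions with no move have nimber $0$, and every other position has nimber equal to the least non-negative integer that is not the nimber of a position reachable in one move. *)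

(* Defs.v *)
From mathcomp Require Import all_boot.

Set Implicit Arguments.
Unset Strict Implicit.
Unset Printing Implicit Defensive.

(* Finite multigraphs: the vertices are 0, ..., nverts - 1; edges are unordered,
   the two orders (u, v) and (v, u) of an entry denoting the same edge. An edge
   is identified by its index in the list, so that parallel edges are distinct. *)
Record multigraph := Multigraph { nverts : nat; edges : seq (nat * nat) }.

Definition joins (e : nat * nat) (u v : nat) : bool :=
  (e == (u, v)) || (e == (v, u)).

(* Cycle through the distinct vertices vs_0, ..., vs_(k-1) and the distinct edges
   of indices es_0, ..., es_(k-1), where es_i joins vs_i and vs_(i+1 mod k).
   k = 1 is a loop and k = 2 a pair of parallel edges. *)
Definition is_cycle (G : multigraph) (vs es : seq nat) : Prop :=
  [/\ 0 < size vs, size es = size vs, uniq vs, uniq es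
    & forall i, i < size vs ->
        nth 0 es i < size (edges G) /\
        joins (nth (0, 0) (edges G) (nth 0 es i))
              (nth 0 vs i) (nth 0 vs (i.+1 %% size vs))].

(* None stands for infinite girth *)
Definition has_girth (G : multigraph) (g : option nat) : Prop :=
  if g is Some k then
    (exists vs es, is_cycle G vs es /\ size vs = k) /\
    (forall vs es, is_cycle G vs es -> k <= size vs)
  else forall vs es, ~ is_cycle G vs es.

(* Drawings in the plane of a multigraph together with some open tips, up to
   deformation. Such a drawing is given by its regions (the connected components
   of the complement); it is not recorded which region is the unbounded one,
   since this has no influence on the curves that can be drawn.
   A boundary is a connected component of the boundary of a region. It is the
   word of the open tips met when walking once along the component with the
   region on the left, a tip being represented by the vertex it comes out of.
   A boundary is a cyclic word: the point where the walk starts is immaterial.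
   A region is the list of its boundaries (there are several of them when the
   drawing is disconnected); the order of the boundaries of a region, and of the
   regions of a drawing, is immaterial. *)
Definition boundary := seq nat.
Definition region := seq boundary.

Record drawing := Drawing { graph : multigraph; regions : seq region }.

(* draw_curve m u v R R': starting from the regions R, a curve crossing nothing
   is drawn inside one of them, from an open tip of u to another open tip of v;
   the two tips are no longer open, and the new open tips m are left on each of
   the two sides of the curve (m has at most one element below). R' are the
   resulting regions.
   - Tips on the same boundary: the curve cuts the region in two, w and a ++ b
     being the parts of the boundary on each side, and each of the other
     boundaries of the region may lie on either side.
   - Tips on two different boundaries: these merge into a single one, which runs
     along both sides of the curve. *)
Inductive draw_curve (m : seq nat) (u v : nat) (R R' : seq region) : Prop :=
| DrawSplit (r : region) (S : seq region) (a w b : boundary) (A B : region) of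
    perm_eq R (r :: S)
  & perm_eq r ((a ++ u :: w ++ v :: b) :: A ++ B)
  & perm_eq R' (((m ++ w) :: A) :: ((a ++ m ++ b) :: B) :: S)
| DrawMerge (r : region) (S : seq region) (a b a' b' : boundary) (T : region) of
    perm_eq R (r :: S)
  & perm_eq r ((a ++ u :: b) :: (a' ++ v :: b') :: T)
  & perm_eq R' (((a ++ m ++ b' ++ a' ++ m ++ b) :: T) :: S).

(* Drawings of multigraphs: start from the empty plane, then repeatedly put a new
   vertex with any number k of tips in a region, or join two open tips by a curve
   that becomes an edge. *)
Inductive plane_drawing : drawing -> Prop :=
| PlaneEmpty : plane_drawing (Drawing (Multigraph 0 [::]) [:: [::]])
| PlaneVertex n es R R' r S k of
    plane_drawing (Drawing (Multigraph n es) R)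
  & perm_eq R (r :: S)
  & perm_eq R' (rcons r (nseq k n) :: S) :
    plane_drawing (Drawing (Multigraph n.+1 es) R')
| PlaneEdge n es R R' u v e of
    plane_drawing (Drawing (Multigraph n es) R)
  & draw_curve [::] u v R R'
  & joins e u v :
    plane_drawing (Drawing (Multigraph n (rcons es e)) R').

Definition planar (G : multigraph) : Prop :=
  exists R, plane_drawing (Drawing G R).

Definition P4 (G : multigraph) : Prop :=
  planar G /\
  exists2 g, has_girth G g & if g is Some k then 4 <= k else true.

(* The game BS_2(F : p, q). In a move, the crossbar on the curve joining a tip of
   u and a tip of v creates the vertex n = nverts, the edges u n and n v, and one
   open tip of n on each side of the curve. *)
Definition BS2_start (p q : nat) : drawing :=
  Drawing (Multigraph 2 [::]) [:: [:: nseq p 0; nseq q 1]].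

Inductive BS2_move (F : multigraph -> Prop) (D D' : drawing) : Prop :=
| BS2Move u v of
    draw_curve [:: nverts (graph D)] u v (regions D) (regions D')
  & graph D' = Multigraph (nverts (graph D)).+1
      (edges (graph D) ++ [:: (u, nverts (graph D)); (nverts (graph D), v)])
  & F (graph D').

(* nimber move x n: n is the least natural number that is not the nimber of a
   position reachable from x in one move. Being inductive, it only holds of
   positions from which all plays are finite. *)
Inductive nimber (T : Type) (move : T -> T -> Prop) (x : T) (n : nat) : Prop :=
| Nimber of
    (forall y, move x y -> exists2 k, k <> n & nimber move y k)
  & (forall k, k < n -> exists2 y, move x y & nimber move y k).

Lemma nimber_unique (T : Type) (move : T -> T -> Prop) (x : T) (n n' : nat) :
  nimber move x n -> nimber move x n' -> n = n'.
Proof.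
move: x n n'; fix IH 4 => x n n' [opt low] [opt' low'].
case: (ltngtP n n') => // lt_n.
- case: (low' _ lt_n) => y xy yn; case: (opt y xy) => k kn yk.
  by case: kn; apply: (IH y k n yk yn).
- case: (low _ lt_n) => y xy yn'; case: (opt' y xy) => k kn' yk.
  by case: kn'; apply: (esym (IH y n' k yn' yk)).
Qed.

(* Main.v *)
(* By the girth condition, a move is legal exactly when it joins tips of two
   distinct, non-adjacent vertices. The first move thus joins the spots x and y,
   through a crossbar 2. The second player joins x and y again, through a crossbar
   3 placed so that the two resulting regions have the cyclic boundaries
   2 3 x ... x and 2 3 y ... y, both spots still having at least one tip. In the
   first region the only legal moves join 2 and 3; this leaves the new crossbar n
   alone on one side and n x ... x on the other, where n and x can be joined once,
   after which each side only has tips of x and of a neighbour of x. So exactly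
   two moves remain in each region, whatever the players do: the reply has
   nimber 0, hence every first move has a nonzero nimber. *)
Require Import Defs.
From mathcomp Require Import all_boot.
From mathcomp Require Import zify.
From Stdlib Require Import Classical.

Set Implicit Arguments.
Unset Strict Implicit.
Unset Printing Implicit Defensive.

(** * Existence of nimbers when a measure decreases *)

Lemma least_nat (P : nat -> Prop) n :
  P n -> exists2 k, P k & forall j, j < k -> ~ P j.
Proof.
elim/ltn_ind: n => n IH Pn.
have [[j ltjn Pj]|no] := classic (exists2 j, j < n & P j); first exact: IH Pj.
by exists n => // j ltjn Pj; case: no; exists j.
Qed.

(** By induction each option has a nimber at most its own measure, so below [mu x]. As nimbers are
    unique, no option has nimber [mu x]; the least missed value thus exists and is at most
    [mu x]. *)
Lemma nimber_exists (T : Type) (move : T -> T -> Prop) (P : T -> Prop)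
    (mu : T -> nat) :
  (forall x y, P x -> move x y -> P y /\ mu y < mu x) ->
  forall x, P x -> exists2 k, k <= mu x & nimber move x k.
Proof.
move=> dec x; have [m] := ubnP (mu x); elim: m x => // m IH x lt_x Px.
pose missed k := ~ exists2 y, move x y & nimber move y k.
have miss_mu : missed (mu x).
  case=> y xy yk; have [Py lt_y] := dec _ _ Px xy.
  have [k le_k yk'] := IH y (leq_trans lt_y lt_x) Py.
  by move: le_k; rewrite (nimber_unique yk' yk) leqNgt lt_y.
have [k miss_k low] := least_nat miss_mu.
exists k; first by rewrite leqNgt; apply/negP => /low; apply.
split=> [y xy|j /low/NNPP //].
have [Py lt_y] := dec _ _ Px xy.
have [j _ yj] := IH y (leq_trans lt_y lt_x) Py.
by exists j => // eq_jk; apply: miss_k; exists y; rewrite -?eq_jk.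
Qed.

(** * Girth at least 4 in terms of adjacency *)

Definition adj (E : seq (nat * nat)) (x y : nat) : bool :=
  has (fun e => joins e x y) E.

Definition below (n : nat) (E : seq (nat * nat)) : bool :=
  all (fun e => (e.1 < n) && (e.2 < n)) E.

Definition extend (E : seq (nat * nat)) (n u v : nat) : seq (nat * nat) :=
  E ++ [:: (u, n); (n, v)].

Lemma joinsE e x y :
  joins e x y = ((e.1 == x) && (e.2 == y)) || ((e.1 == y) && (e.2 == x)).
Proof. by case: e. Qed.

Lemma adj_extend E n u v x y :
  adj (extend E n u v) x y = [|| adj E x y, joins (u, n) x y | joins (n, v) x y].
Proof. by rewrite /adj has_cat /= orbF. Qed.

Lemma below_adj n E x y : below n E -> adj E x y -> (x < n) && (y < n).
Proof.
move=> /allP En /hasP[e /En/andP[]]; rewrite joinsE => e1 e2.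
by case/orP=> /andP[/eqP <- /eqP <-]; rewrite e1 e2.
Qed.

Lemma adjC E x y : adj E x y = adj E y x.
Proof. by apply: eq_has => e; rewrite /joins orbC. Qed.

Lemma adj_extend_old E n u v x y : x < n -> y < n ->
  adj (extend E n u v) x y = adj E x y.
Proof. by move=> xn yn; rewrite adj_extend !joinsE /=; case: adj => //=; lia. Qed.

(** The clauses exclude cycles of length 1, 2 and 3. The second compares entries at distinct
    positions, since parallel edges differ only by their index. *)
Definition no_short_cycle (E : seq (nat * nat)) : Prop :=
  [/\ all (fun e => e.1 != e.2) E, pairwise (fun e f => ~~ joins e f.1 f.2) E
    & forall x y z, adj E x y -> adj E y z -> ~~ adj E z x].

Lemma no_short_cycleP G : no_short_cycle (edges G) ->
  forall vs es, is_cycle G vs es -> 4 <= size vs.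
Proof.
case=> /all_nthP noloop /(pairwiseP (0, 0)) nopar notri vs es [vs0 ses _ ues cyc].
set E := edges G in noloop nopar notri cyc *.
have adj_nth i x y : i < size E -> joins (nth (0, 0) E i) x y -> adj E x y.
  by move=> iE ixy; apply/hasP; exists (nth (0, 0) E i); rewrite ?mem_nth.
case: vs es vs0 ses ues cyc => [|x [|y [|z [|t vs]]]] [|i [|j [|k [|l es]]]] //= _ _ ues cyc.
- have [iE] := cyc 0 isT; rewrite joinsE /=.
  by have := noloop (0, 0) i iE; case: nth => c d /=; lia.
- have [/= iE exy] := cyc 0 isT; have [/= jE eyx] := cyc 1 isT.
  move: ues; rewrite inE andbT.
  have := nopar i j; have := nopar j i; rewrite !inE => /(_ jE iE) + /(_ iE jE).
  move: exy eyx; rewrite !joinsE /=.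
  by case: (nth _ E i) => a b; case: (nth _ E j) => c d /=; lia.
- have [/= iE exy] := cyc 0 isT; have [/= jE eyz] := cyc 1 isT.
  have [/= kE ezx] := cyc 2 isT.
  by have /negP[] := notri x y z (adj_nth _ _ _ iE exy) (adj_nth _ _ _ jE eyz);
    apply: adj_nth kE ezx.
Qed.

(** The fresh vertex [n] has only the neighbours [u] and [v], which are distinct and not adjacent;
    so [n] lies on no 2-cycle and on no triangle. *)
Lemma no_short_cycle_extend E n u v : below n E -> no_short_cycle E ->
  u < n -> v < n -> u != v -> ~~ adj E u v -> no_short_cycle (extend E n u v).
Proof.
move=> En [noloop nopar notri] un vn uv nuv; split.
- by rewrite all_cat noloop /=; lia.
- rewrite pairwise_cat nopar /= !andbT; apply/andP; split; last first.
    by rewrite joinsE /=; lia.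
  apply/allrelP => e f /(allP En); rewrite !inE joinsE.
  by case: e => a b /= ab /orP[] /eqP -> /=; lia.
- move=> x y z; rewrite !adj_extend.
  have := notri x y z; move: nuv.
  have := below_adj (x := x) (y := y) En; have := below_adj (x := y) (y := z) En.
  have := below_adj (x := z) (y := x) En.
  rewrite !joinsE /=.
  (* Equalities between vertices are carried into [adj E] by hand, as [lia] cannot rewrite there. *)
  have adj_uv x' y' : x' = u -> y' = v -> ~~ adj E u v -> ~~ adj E x' y' && ~~ adj E y' x'.
    by move=> -> ->; rewrite (adjC E v u) => ->.
  have irr x' y' : x' = y' -> ~~ adj E x' y'.
    move=> <-; apply/hasPn => e /(allP noloop); rewrite joinsE; case: e => a b /=; lia.
  move: (adj_uv x y) (adj_uv y z) (adj_uv z x) (adj_uv y x) (adj_uv z y) (adj_uv x z).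
  move: (irr x y) (irr y z) (irr z x).
  rewrite (adjC E y x) (adjC E z y) (adjC E x z).
  by case: (adj E u v) => //; case: (adj E x y); case: (adj E y z); case: (adj E z x) => /=; lia.
Qed.

(** A girth has to be exhibited: classically, it is infinite or the least length of a cycle. *)
Lemma P4_no_short_cycle G : planar G -> no_short_cycle (edges G) -> P4 G.
Proof.
move=> planG /no_short_cycleP girth4; split=> //.
have [[k0 cyc0]|nocyc] :=
  classic (exists k, exists vs es, is_cycle G vs es /\ size vs = k).
- have [k [vs [es [cyc <-]]] low] :=
    least_nat (P := fun k => exists vs es, is_cycle G vs es /\ size vs = k) cyc0.
  exists (Some (size vs)); last exact: girth4 cyc.
  split=> [|vs' es' cyc']; first by exists vs, es.
  by rewrite leqNgt; apply/negP => /low; apply; exists vs', es'.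
- by exists None => // vs es cyc; apply: nocyc; exists (size vs), vs, es.
Qed.

Lemma P4_cycle G vs es : P4 G -> is_cycle G vs es -> 4 <= size vs.
Proof.
by case=> _ [[k|] girth k4] cyc; [apply: leq_trans k4 (girth.2 _ _ cyc) | case: (girth _ _ cyc)].
Qed.

(** If [u = v] the two new edges are parallel; if [u] and [v] are adjacent they close a triangle
    with an old edge. *)
Lemma P4_extend E n u v : u < n -> v < n ->
  P4 (Multigraph n.+1 (extend E n u v)) -> (u != v) && ~~ adj E u v.
Proof.
move=> un vn P4E; apply/andP.
(* The new edges have the indices [size E] and [size E + 1]. *)
have nE i x : nth x (extend E n u v) (size E + i) = nth x [:: (u, n); (n, v)] i.
  by rewrite nth_cat ltnNge leq_addr /= addKn.
have nE0 := nE 0 (0, 0); have nE1 := nE 1 (0, 0); rewrite addn0 /= in nE0 nE1.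
have szE : size (extend E n u v) = (size E).+2 by rewrite size_cat addn2.
have uv : u != v.
  apply/negP => /eqP eq_uv.
  suff /(P4_cycle P4E) : is_cycle (Multigraph n.+1 (extend E n u v))
      [:: u; n] [:: size E; size E + 1] by [].
  split=> //=; rewrite ?inE ?szE; [lia | lia |].
  case=> [|[|//]] _ /=; rewrite ?nE0 ?nE1 joinsE /=; lia.
split=> //; apply/negP => /(has_nthP (0, 0))[i iE iuv].
suff /(P4_cycle P4E) : is_cycle (Multigraph n.+1 (extend E n u v))
    [:: u; n; v] [:: size E; size E + 1; i] by [].
split=> //=; rewrite ?inE ?szE; [lia | lia |].
case=> [|[|[|//]]] _ /=; rewrite ?nE0 ?nE1 ?joinsE /=; [lia | lia |].
by split; [lia | rewrite nth_cat iE -joinsE /joins orbC].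
Qed.

(** * Planarity of the positions *)

(** A move is simulated by drawing rules: put [n] in the region with four tips, join one to [u] and
    the opposite one to [v]; the other two are the ends of the crossbar. *)
Lemma plane_drawing_move n E R R' u v :
  plane_drawing (Drawing (Multigraph n E) R) -> draw_curve [:: n] u v R R' ->
  plane_drawing (Drawing (Multigraph n.+1 (extend E n u v)) R').
Proof.
have -> : extend E n u v = rcons (rcons E (u, n)) (n, v) by rewrite -!cats1 -catA.
move=> D.
case=> [r S a w b A B RrS rE R'E | r S a b a' b' T RrS rE R'E].
- have D1 := PlaneVertex (k := 4) D RrS (perm_refl _).
  apply: (PlaneEdge (u := n) (v := v) (R := ((a ++ [:: n, n, n & w ++ v :: b]) :: A ++ B) :: S)).
  + apply: (PlaneEdge (u := u) (v := n) D1); last by rewrite /joins eqxx.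
    apply: (DrawMerge (a := a) (b := w ++ v :: b) (a' := [::]) (b' := [:: n; n; n])
      (perm_refl _) _ (perm_refl _)).
    rewrite perm_rcons -[_ :: nseq 4 n :: _](cat1s _ ([:: nseq 4 n] ++ _)).
    by rewrite perm_sym perm_catCA perm_sym perm_cons.
  (* Of the three tips left at [n], the middle one is joined to [v], so that one stays on each
     side. *)
  + apply: (DrawSplit (r := (a ++ [:: n, n, n & w ++ v :: b]) :: A ++ B) (S := S)
      (a := a ++ [:: n]) (w := n :: w) (b := b) (A := A) (B := B)) => //.
      by rewrite -catA.
    by rewrite -catA.
  + by rewrite /joins eqxx.
- have D1 := PlaneVertex (k := 4) D RrS (perm_refl _).
  apply: (PlaneEdge (u := n) (v := v)
    (R := ((a ++ [:: n, n, n & b]) :: (a' ++ v :: b') :: T) :: S)).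
  + apply: (PlaneEdge (u := u) (v := n) D1); last by rewrite /joins eqxx.
    apply: (DrawMerge (a := a) (b := b) (a' := [::]) (b' := [:: n; n; n])
      (perm_refl _) _ (perm_refl _)).
    rewrite perm_rcons -[_ :: nseq 4 n :: _](cat1s _ ([:: nseq 4 n] ++ _)).
    by rewrite perm_sym perm_catCA perm_sym perm_cons.
  + apply: (DrawMerge (a := a ++ [:: n]) (b := n :: b) (a' := a') (b' := b') (T := T)
      (perm_refl _)); first by rewrite -catA.
    by rewrite -catA.
  + by rewrite /joins eqxx.
Qed.

(** * Regular positions and their legal moves *)

Definition tips (R : seq region) : seq nat := flatten (flatten R).

Lemma perm_tips R R' : perm_eq R R' -> perm_eq (tips R) (tips R').
Proof. by move=> RR'; do 2!apply: perm_flatten. Qed.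

(** Invariant of the play: the bounds make the next crossbar a fresh vertex, and the other two
    fields give membership in [P4]. *)
Record regular_position (D : drawing) : Prop := RegularPosition {
  regular_plane : plane_drawing D;
  regular_edges : below (nverts (graph D)) (edges (graph D));
  regular_tips : {in tips (regions D), forall x, x < nverts (graph D)};
  regular_cycles : no_short_cycle (edges (graph D)) }.

Lemma perm_tips_cons R r r' S : perm_eq R (r :: S) -> perm_eq r r' ->
  perm_eq (tips R) (flatten r' ++ tips S).
Proof.
move=> /perm_tips/permPl-> rr'; rewrite /tips /= flatten_cat perm_cat2r.
exact: perm_flatten.
Qed.

Lemma tips_cons (s : boundary) r S :
  tips ((s :: r) :: S) = s ++ flatten r ++ tips S.
Proof. by rewrite /tips /= flatten_cat. Qed.

Lemma draw_curve_tips m u v R R' : draw_curve m u v R R' ->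
  [/\ u \in tips R, v \in tips R & {subset tips R' <= m ++ tips R}].
Proof.
case=> [r S a w b A B RrS rE R'E | r S a b a' b' T RrS rE R'E].
- have tR x : (x \in tips R) = (x \in (a ++ u :: w ++ v :: b) ++ flatten (A ++ B) ++ tips S).
    by rewrite (perm_mem (perm_tips_cons RrS rE) x) /= !catA.
  split=> [||x]; rewrite ?tR; try by rewrite /= !(mem_cat, inE) eqxx !orbT.
  rewrite (perm_mem (perm_tips R'E)) [x \in m ++ _]mem_cat tR !tips_cons.
  by rewrite !(flatten_cat, mem_cat, inE, cat_cons); do !case: (x \in _); rewrite /= ?orbT.
- have tR x : (x \in tips R) = (x \in (a ++ u :: b) ++ (a' ++ v :: b') ++ flatten T ++ tips S).
    by rewrite (perm_mem (perm_tips_cons RrS rE) x) /= !catA.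
  split=> [||x]; rewrite ?tR; try by rewrite /= !(mem_cat, inE) eqxx !orbT.
  rewrite (perm_mem (perm_tips R'E)) [x \in m ++ _]mem_cat tR !tips_cons.
  by rewrite !(flatten_cat, mem_cat, inE, cat_cons); do !case: (x \in _); rewrite /= ?orbT.
Qed.

Lemma below_extend E n u v : below n E -> u < n -> v < n ->
  below n.+1 (extend E n u v).
Proof.
move=> En un vn; rewrite /below all_cat /= andbT; apply/andP; split; last lia.
by apply: sub_all En => e; lia.
Qed.

(* The legality condition of the game: girth at least 4 forbids joining two tips
   of the same vertex (a 2-cycle) or of adjacent vertices (a triangle). *)
Definition joinable E u v : bool := (u != v) && ~~ adj E u v.

Lemma regular_extend D u v R' : regular_position D ->
  draw_curve [:: nverts (graph D)] u v (regions D) R' ->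
  joinable (edges (graph D)) u v ->
  regular_position
    (Drawing (Multigraph (nverts (graph D)).+1
                (extend (edges (graph D)) (nverts (graph D)) u v)) R').
Proof.
case: D => [[n E] R] [/= plane En Rn short] uvR /andP[uv nuv].
have [/Rn un /Rn vn sub] := draw_curve_tips uvR.
split=> /=.
- exact: plane_drawing_move uvR.
- exact: below_extend.
- by move=> x /sub; rewrite inE => /orP[/eqP-> //|/Rn /ltnW].
- exact: no_short_cycle_extend.
Qed.

Lemma joinable_move D u v R' : regular_position D ->
  draw_curve [:: nverts (graph D)] u v (regions D) R' ->
  joinable (edges (graph D)) u v ->
  BS2_move P4 D
    (Drawing (Multigraph (nverts (graph D)).+1
                (extend (edges (graph D)) (nverts (graph D)) u v)) R').
Proof.
move=> regD uvR juv; have [plane _ _ short] := regular_extend regD uvR juv.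
by apply: (BS2Move (u := u) (v := v)) => //=; apply: P4_no_short_cycle => //; exists R'.
Qed.

Lemma move_joinable D D' : regular_position D -> BS2_move P4 D D' ->
  exists u v, [/\ draw_curve [:: nverts (graph D)] u v (regions D) (regions D'),
    graph D' = Multigraph (nverts (graph D)).+1
                 (extend (edges (graph D)) (nverts (graph D)) u v)
    & joinable (edges (graph D)) u v].
Proof.
move=> regD [u v uvR gD' P4D']; exists u, v; split=> //.
have [u_in v_in _] := draw_curve_tips uvR.
apply: (@P4_extend _ (nverts (graph D))); last by rewrite -[extend _ _ _ _]/(_ ++ _) -gD'.
- exact: regular_tips u_in.
- exact: regular_tips v_in.
Qed.

Lemma regular_move D D' : regular_position D -> BS2_move P4 D D' ->
  regular_position D'.
Proof.
move=> regD DD'; have [u [v [uvR gD' juv]]] := move_joinable regD DD'.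
by case: D' gD' uvR {DD'} => g R' /= -> uvR; apply: regular_extend.
Qed.

(** * Regions with a fixed number of remaining moves *)

(* [moves_left E k s]: in a region whose only boundary is [s], every play
   consists of exactly [k] moves, whatever is done in the other regions. *)
Inductive moves_left (E : seq (nat * nat)) : nat -> boundary -> Prop :=
| NoMove s of {in s &, forall u v, ~~ joinable E u v} : moves_left E 0 s
| OneMove x y i j of joinable E x y & 0 < i + j :
    moves_left E 1 (nseq i x ++ y :: nseq j x)
| TwoMoves x s t i j of adj E x s & adj E x t & joinable E s t & 0 < i + j :
    moves_left E 2 (nseq i x ++ s :: t :: nseq j x)
| TwoMovesEnds x s t c of adj E x s & adj E x t & joinable E s t & 0 < c :
    moves_left E 2 (s :: nseq c x ++ [:: t]).

Lemma joinableC E u v : joinable E u v = joinable E v u.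
Proof. by rewrite /joinable eq_sym adjC. Qed.

Lemma joinable_extend_old E n u v x y : x < n -> y < n ->
  joinable (extend E n u v) x y = joinable E x y.
Proof. by move=> xn yn; rewrite /joinable adj_extend_old. Qed.

(** A move elsewhere only adds edges at the fresh vertex [n], so adjacency between the tips of this
    region is unchanged. *)
Lemma moves_left_extend E n u v k s : {in s, forall x, x < n} ->
  moves_left E k s -> moves_left (extend E n u v) k s.
Proof.
move=> sn ks; case: ks sn => {k s} [s nj|x y i j xy ij|x s t i j xs xt st ij|x s t c xs xt st c0] sn.
- by apply: NoMove => x y xs ys; rewrite joinable_extend_old ?nj ?sn.
- have [xn yn] : x < n /\ y < n.
    by split; apply: sn; rewrite !(mem_cat, inE, mem_nseq) !eqxx ?orbT //; lia.
  by apply: OneMove; rewrite ?joinable_extend_old.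
- have [xn sn' tn] : [/\ x < n, s < n & t < n].
    by split; apply: sn; rewrite !(mem_cat, inE, mem_nseq) !eqxx ?orbT //; lia.
  by apply: TwoMoves; rewrite ?joinable_extend_old ?adj_extend_old.
- have [xn sn' tn] : [/\ x < n, s < n & t < n].
    by split; apply: sn; rewrite !(mem_cat, inE, mem_nseq) !eqxx ?orbT //; lia.
  by apply: TwoMovesEnds; rewrite ?joinable_extend_old ?adj_extend_old.
Qed.

Lemma moves_left_live E k s : moves_left E k.+1 s ->
  exists a u w v b, s = a ++ u :: w ++ v :: b /\ joinable E u v.
Proof.
move eq_k : k.+1 => k' ks; case: ks eq_k => {k' s} // [x y i j xy ij|x s t i j _ _ st _|x s t c _ _ st _] _.
- case: i ij => [|i] ij.
    case: j ij => // j _; exists [::], y, [::], x, (nseq j x).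
    by rewrite joinableC.
  exists (nseq i x), x, [::], y, (nseq j x).
  by rewrite -addn1 nseqD -catA.
- by exists (nseq i x), s, [::], t, (nseq j x).
- by exists [::], s, (nseq c x), t, [::].
Qed.

Lemma count_predC1_eq0 (x : nat) s : count (predC1 x) s = 0 -> s = nseq (size s) x.
Proof.
by move=> s0; apply/all_pred1P; rewrite all_count -(count_predC (pred1 x)) s0 addn0.
Qed.

(** The letters [u] and [v] already account for all letters of the word other than [x], so the
    remaining pieces are constant. *)
Lemma split_nseq (x u v : nat) (a w b s : seq nat) : a ++ u :: w ++ v :: b = s ->
  count (predC1 x) s <= (u != x) + (v != x) ->
  [/\ a = nseq (size a) x, w = nseq (size w) x, b = nseq (size b) x
    & count (predC1 x) s = (u != x) + (v != x)].
Proof.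
move=> <-; rewrite count_cat /= count_cat /=.
move: (@count_predC1_eq0 x a) (@count_predC1_eq0 x w) (@count_predC1_eq0 x b).
move: (count _ a) (count _ w) (count _ b) => ca cw cb aE wE bE le_s.
by split; [apply: aE | apply: wE | apply: bE |]; lia.
Qed.

Lemma find_nseq_cat (x y : nat) i s : y != x ->
  find (predC1 x) (nseq i x ++ y :: s) = i.
Proof. by move=> yx; elim: i => [|i IH] /=; rewrite ?yx ?eqxx //= IH. Qed.

Lemma nseq_cat_inj (x y y' : nat) i j s s' : y != x -> y' != x ->
  nseq i x ++ y :: s = nseq j x ++ y' :: s' -> [/\ i = j, y = y' & s = s'].
Proof.
move=> yx yx' eq_s; have eq_ij : i = j.
  by rewrite -(find_nseq_cat i s yx) eq_s find_nseq_cat.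
by move/eqP: eq_s; rewrite eq_ij eqseq_cat ?eqxx //= => /eqP[].
Qed.

(** Since [x] is adjacent to [s] and [t], a joinable pair among the three can only consist of [s]
    and [t]. *)
Lemma joinable_neighbors E x s t u v : adj E x s -> adj E x t ->
  joinable E u v -> u \in [:: x; s; t] -> v \in [:: x; s; t] ->
  [/\ u != x, v != x, s != x & t != x].
Proof.
rewrite /joinable !inE => xs xt /andP[uv nuv] u_in v_in.
have ux : u != x.
  apply/eqP => ux; move: uv nuv; rewrite ux eq_sym; case/or3P: v_in => /eqP->;
    by rewrite ?eqxx ?xs ?xt.
have vx : v != x.
  apply/eqP => vx; move: uv nuv; rewrite vx adjC; case/or3P: u_in => /eqP->;
    by rewrite ?eqxx ?xs ?xt.
by split=> //; lia.
Qed.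

(** With one move left, [x] and [y] get joined and both sides die. With two left, only [s] and [t]
    can be joined: one side is [n] alone, the other has [n] and copies of [x], which allow one more
    move. *)
Lemma moves_left_split E n k a u w v b : below n E ->
  {in a ++ u :: w ++ v :: b, forall x, x < n} -> joinable E u v ->
  moves_left E k (a ++ u :: w ++ v :: b) ->
  exists k1 k2, [/\ k = (k1 + k2).+1, moves_left (extend E n u v) k1 (n :: w)
    & moves_left (extend E n u v) k2 (a ++ n :: b)].
Proof.
move=> En sn juv ks.
have [u_s v_s] : u \in a ++ u :: w ++ v :: b /\ v \in a ++ u :: w ++ v :: b.
  by rewrite !(mem_cat, inE) !eqxx !orbT.
have [un vn] := (sn u u_s, sn v v_s).
have [uv nuv] := andP juv.
(* The crossbar [n] is adjacent to both [u] and [v], hence to [x] here. *)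
have idle x c d : (x == u) || (x == v) ->
    moves_left (extend E n u v) 0 (nseq c x ++ n :: nseq d x).
  move=> xuv; have nx : adj (extend E n u v) n x.
    by rewrite adj_extend !joinsE /=; move: xuv; case: adj => //=; lia.
  apply: NoMove => y z; rewrite !(mem_cat, inE, mem_nseq) /joinable => y_in z_in.
  have yE : (y == n) || (y == x) by lia.
  have zE : (z == n) || (z == x) by lia.
  by case/orP: yE => /eqP->; case/orP: zE => /eqP->; rewrite ?eqxx // ?(adjC _ x n) nx andbF.
have single : moves_left (extend E n u v) 0 [:: n].
  by apply: NoMove => y z; rewrite !inE => /eqP-> /eqP->; rewrite /joinable eqxx.
have fresh x : x < n -> x != u -> x != v -> joinable (extend E n u v) x n.
  move=> xn xu xv; rewrite /joinable adj_extend !joinsE /=.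
  have -> : adj E x n = false by apply/negP => /(below_adj En); lia.
  by lia.
move eq_s : (a ++ u :: w ++ v :: b) => s in ks sn u_s v_s.
case: ks eq_s sn u_s v_s => {k s}
  [s nj|x y i j xy ij|x s t i j xs xt st ij|x s t c xs xt st c0] eq_s sn u_s v_s.
- by have := nj u v u_s v_s; rewrite juv.
- have /andP[xy' _] := xy.
  have cnt : count (predC1 x) (nseq i x ++ y :: nseq j x) = 1.
    by rewrite count_cat /= !count_nseq /= eqxx eq_sym xy'.
  have [|aE wE bE] := split_nseq eq_s (x := x); first by rewrite cnt; lia.
  rewrite cnt => cnt'; exists 0, 0; split=> //.
    by rewrite wE; apply: (idle x 0); lia.
  by rewrite aE bE; apply: idle; lia.
- have mem_x z : z \in nseq i x ++ s :: t :: nseq j x -> z \in [:: x; s; t].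
    by rewrite !(mem_cat, inE, mem_nseq); lia.
  have [ux vx sx tx] := joinable_neighbors xs xt juv (mem_x _ u_s) (mem_x _ v_s).
  have cnt : count (predC1 x) (nseq i x ++ s :: t :: nseq j x) = 2.
    by rewrite count_cat /= !count_nseq /= eqxx sx tx.
  have [|aE wE bE _] := split_nseq eq_s (x := x); first by rewrite cnt ux vx.
  have xn : x < n by have := below_adj En xs; lia.
  rewrite aE wE in eq_s; have [ai _ eq_w] := nseq_cat_inj ux sx eq_s.
  have [w0 _ bj] := nseq_cat_inj (j := 0) vx tx eq_w.
  exists 0, 1; rewrite wE w0 aE ai bj; split=> //.
  by apply: OneMove => //; apply: fresh; rewrite // eq_sym.
(* This word is the previous shape up to rotation; now the copies of [x] lie between the joined
   tips. *)
- have mem_x z : z \in s :: nseq c x ++ [:: t] -> z \in [:: x; s; t].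
    by rewrite !(mem_cat, inE, mem_nseq); lia.
  have [ux vx sx tx] := joinable_neighbors xs xt juv (mem_x _ u_s) (mem_x _ v_s).
  have cnt : count (predC1 x) (s :: nseq c x ++ [:: t]) = 2.
    by rewrite /= count_cat /= !count_nseq /= eqxx sx tx.
  have [|aE wE bE _] := split_nseq eq_s (x := x); first by rewrite cnt ux vx.
  have xn : x < n by have := below_adj En xs; lia.
  rewrite aE wE in eq_s; have [a0 _ eq_w] := nseq_cat_inj (j := 0) ux sx eq_s.
  have [wc _ b0] := nseq_cat_inj vx tx eq_w.
  exists 1, 0; rewrite b0 aE a0 wE wc; split=> //.
  by apply: (OneMove (i := 0)) => //; apply: fresh; rewrite // eq_sym.
Qed.

(** * Positions whose number of remaining moves is fixed *)

(** Each region has a single boundary, labelled by its number of moves. This rules out merging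
    curves and makes the regions independent. *)
Definition total_moves_left E (R : seq region) (N : nat) : Prop :=
  exists s : seq (nat * boundary),
    [/\ perm_eq R [seq [:: p.2] | p <- s],
        {in s, forall p, moves_left E p.1 p.2} & N = \sum_(p <- s) p.1].

Lemma mem_tips (R : seq region) (s : boundary) x : [:: s] \in R -> x \in s -> x \in tips R.
Proof.
move=> sR xs; apply/flattenP; exists s => //.
by apply/flattenP; exists [:: s]; rewrite ?mem_head.
Qed.

Lemma total_moves_left_live D N : total_moves_left (edges (graph D)) (regions D) N.+1 ->
  exists u v R', draw_curve [:: nverts (graph D)] u v (regions D) R' /\
    joinable (edges (graph D)) u v.
Proof.
case=> s [Rs ks sumE].
have /hasP[[k t] ps k0] : has (fun p => 0 < p.1) s.
  apply: contraPT sumE => /hasPn nos; rewrite big_seq big1 // => p /nos.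
  by rewrite lt0n negbK => /eqP.
move: k0 ps => /=; case: k => // k _ ps.
have [a [u [w [v [b [tE juv]]]]]] := moves_left_live (ks _ ps).
have tR : [:: t] \in regions D by rewrite (perm_mem Rs); apply/mapP; exists (k.+1, t).
exists u, v; eexists; split; last exact: juv.
apply: (DrawSplit (a := a) (w := w) (b := b) (A := [::]) (B := [::]) (perm_to_rem tR)).
  by rewrite -tE.
exact: perm_refl.
Qed.

Lemma total_moves_left_move D D' N : regular_position D -> BS2_move P4 D D' ->
  total_moves_left (edges (graph D)) (regions D) N ->
  0 < N /\ total_moves_left (edges (graph D')) (regions D') N.-1.
Proof.
move=> regD DD' [s [Rs ks ->]]; have [u [v [uvR gD' juv]]] := move_joinable regD DD'.
have En := regular_edges regD; rewrite gD' /=.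
move: (nverts (graph D)) (edges (graph D)) juv ks En (regular_tips regD) uvR => n E juv ks En Rn.
have tip_lt p : p \in s -> {in p.2, forall x, x < n}.
  move=> ps x /mem_tips xp; apply/Rn/xp.
  by rewrite (perm_mem Rs); apply/mapP; exists p.
have single r S : perm_eq (regions D) (r :: S) ->
    exists2 p, p \in s & r = [:: p.2] /\ perm_eq S [seq [:: q.2] | q <- rem p s].
  move=> RrS; have : r \in regions D by rewrite (perm_mem RrS) mem_head.
  rewrite (perm_mem Rs) => /mapP[p ps rE]; exists p; rewrite -?rE //; split=> //.
  rewrite -(perm_cons r) {2}rE -(map_cons (fun q => [:: q.2]) p).
  rewrite -(permPl RrS) (permPl Rs); apply: perm_map; exact: perm_to_rem.
case=> [r S a w b A B RrS rE R'E | r S a b a' b' T RrS rE R'E].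
- have [p ps [rp Sp]] := single r S RrS.
  have [sE /nilP AB] : a ++ u :: w ++ v :: b = p.2 /\ nilp (A ++ B).
    have := perm_size rE; have := perm_mem rE (a ++ u :: w ++ v :: b).
    by rewrite rp mem_head inE => /eqP-> /= [/esym/size0nil->].
  have {AB} [A0 B0] : A = [::] /\ B = [::] by case: A B AB {rE R'E} => [|? ?] [|? ?].
  have [k1 [k2 [pE m1 m2]]] : exists k1 k2, [/\ p.1 = (k1 + k2).+1,
      moves_left (extend E n u v) k1 (n :: w) & moves_left (extend E n u v) k2 (a ++ n :: b)].
    by apply: moves_left_split; rewrite ?sE //; [apply: tip_lt | apply: ks].
  rewrite (perm_big _ (perm_to_rem ps)) big_cons pE; split=> //.
  exists ((k1, n :: w) :: (k2, a ++ n :: b) :: rem p s); split.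
  + by rewrite (permPl R'E) A0 B0 /= !perm_cons.
  + move=> q; rewrite !inE => /or3P[/eqP->|/eqP->|/mem_rem qs] //.
    by apply: moves_left_extend; [apply: tip_lt | apply: ks].
  + by rewrite !big_cons /= addnA.
(* Merging would need two boundaries in one region. *)
- have [p ps [rp Sp]] := single r S RrS.
  by move/perm_size: rE; rewrite rp.
Qed.

(** All plays have the same length [N], so only its parity matters: all options share the nimber of
    the opposite parity. *)
Lemma total_moves_left_nimber D N : regular_position D ->
  total_moves_left (edges (graph D)) (regions D) N ->
  nimber (BS2_move P4) D (odd N).
Proof.
elim: N D => [|N IH] D regD DN; split=> [D' DD'|k].
- by have [] := total_moves_left_move regD DD' DN.
- by [].
- have [_ D'N] := total_moves_left_move regD DD' DN.
  exists (odd N); first by move=> /=; case: odd.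
  exact: IH (regular_move regD DD') D'N.
- rewrite /=; case oddN: (odd N); case: k => // _.
  have [u [v [R' [uvR juv]]]] := total_moves_left_live DN.
  have DD' := joinable_move regD uvR juv.
  eexists; first exact: DD'.
  have [_ D'N] := total_moves_left_move regD DD' DN.
  by have := IH _ (regular_move regD DD') D'N; rewrite oddN.
Qed.

(** * Termination of the game *)

(* Every boundary counts its tips plus one, so that a region with at least one
   tip weighs at least 2. A move keeps the number of tips, and either splits a
   region or merges two boundaries, so the total excess over 2 drops by 1. *)
Definition weight (r : region) : nat := \sum_(s <- r) (size s).+1.

Definition excess (D : drawing) : nat := \sum_(r <- regions D) (weight r - 2).

Lemma excess_move F D D' : all (fun r => 2 <= weight r) (regions D) ->
  BS2_move F D D' ->
  all (fun r => 2 <= weight r) (regions D') /\ excess D' < excess D.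
Proof.
rewrite /excess => w2 [u v uvR _ _].
have perm_weight r r' : perm_eq r r' -> weight r = weight r'.
  by move=> rr'; apply: perm_big.
case: uvR => [r S a w b A B RrS /perm_weight rE R'E | r S a b a' b' T RrS /perm_weight rE R'E].
(* Splitting adds 1 to the total weight, but 2 is subtracted for one more region. *)
- move: w2; rewrite (perm_all _ RrS) (perm_all _ R'E) !(perm_big _ RrS) (perm_big _ R'E).
  rewrite /= !big_cons rE /weight !big_cons !big_cat /= !size_cat /= ?size_cat /=.
  case/andP=> _ ->; lia.
(* Merging removes 1 from the weight of the region, which remains at least 2 thanks to the crossbar
   tips. *)
- move: w2; rewrite (perm_all _ RrS) (perm_all _ R'E) !(perm_big _ RrS) (perm_big _ R'E).
  rewrite /= !big_cons rE /weight !big_cons /= !size_cat /= ?size_cat /=.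
  case/andP=> _ ->; lia.
Qed.

(** * The first move and the winning reply *)

Lemma plane_drawing_start p q : plane_drawing (BS2_start p q).
Proof.
have D0 := PlaneVertex (k := p) PlaneEmpty (perm_refl _) (perm_refl _).
exact: (PlaneVertex (k := q) D0 (perm_refl _) (perm_refl _)).
Qed.

Lemma regular_start p q : regular_position (BS2_start p q).
Proof.
split=> //=; first exact: plane_drawing_start.
by move=> x; rewrite /tips /= cats0 mem_cat !mem_nseq; lia.
Qed.

Lemma cat_cons_nseq (x y : nat) a b k : a ++ y :: b = nseq k x ->
  [/\ y = x, a = nseq (size a) x, b = nseq (size b) x & size a + size b = k.-1].
Proof.
move=> eq_k; have := congr1 size eq_k; rewrite size_cat size_nseq /= addnS => <-.
have : all (pred1 x) (a ++ y :: b) by rewrite eq_k all_pred1_nseq.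
by rewrite all_cat => /and3P[/all_pred1P ? /eqP ? /all_pred1P ?].
Qed.

(** Two tips of one spot cannot be joined, so the first curve merges the two boundaries and uses one
    tip of each spot, leaving at least 2. *)
Lemma first_move p q D : 3 <= p -> 3 <= q -> BS2_move P4 (BS2_start p q) D ->
  exists x y i j c,
    [/\ (x, y) \in [:: (0, 1); (1, 0)], 2 <= i + j, 2 <= c,
        graph D = Multigraph 3 (extend [::] 2 x y)
      & perm_eq (regions D)
          [:: [:: nseq i x ++ 2 :: nseq c y ++ 2 :: nseq j x]]].
Proof.
move=> hp hq DD'; have [u [v []]] := move_joinable (regular_start p q) DD'.
rewrite /= => uvR gD' /andP[uv _].
have single (r : region) S :
    perm_eq [:: [:: nseq p 0; nseq q 1]] (r :: S) -> r = [:: nseq p 0; nseq q 1] /\ S = [::].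
  move=> rS; have := perm_size rS; case: S rS => // rS _.
  by have := perm_mem rS r; rewrite mem_head inE => /eqP.
case: uvR => [r S a w b A B /single[-> _] rE _ | r S a b a' b' T /single[-> ->] rE R'E].
- have := perm_mem rE (a ++ u :: w ++ v :: b); rewrite mem_head !inE.
  by case/orP=> /eqP/cat_cons_nseq[uE _ /cat_cons_nseq[vE _ _ _] _];
    rewrite uE vE eqxx in uv.
- have T0 : T = [::] by have := perm_size rE; case: (T).
  rewrite {}T0 in rE R'E.
  have : exists x y k l, [/\ (x, y) \in [:: (0, 1); (1, 0)], 3 <= k, 3 <= l,
      a ++ u :: b = nseq k x & a' ++ v :: b' = nseq l y].
    have := perm_mem rE (a ++ u :: b); rewrite mem_head !inE => /orP[]/eqP abE.
      exists 0, 1, p, q; split=> //; move: rE; rewrite abE perm_cons => rE.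
      by have := perm_mem rE (a' ++ v :: b'); rewrite mem_head inE => /eqP.
    exists 1, 0, q, p; split=> //; move: rE; rewrite abE.
    rewrite -(cat1s (nseq p 0)) perm_catC perm_cons => rE.
    by have := perm_mem rE (a' ++ v :: b'); rewrite mem_head inE => /eqP.
  case=> x [y [k [l [xy k3 l3 /cat_cons_nseq[uE aE bE kE] /cat_cons_nseq[vE a'E b'E lE]]]]].
  (* The tips of [y] form one block [b' ++ a'], those of [x] may be cut by the starting point of the
     word. *)
  exists x, y, (size a), (size b), (size b' + size a'); split=> //; try lia.
    by rewrite gD' uE vE.
  by rewrite (permPl R'E) nseqD -a'E -b'E -aE -bE -catA.
Qed.

Lemma winning_reply D x y i j c : regular_position D ->
  (x, y) \in [:: (0, 1); (1, 0)] -> 2 <= i + j -> 2 <= c ->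
  graph D = Multigraph 3 (extend [::] 2 x y) ->
  perm_eq (regions D) [:: [:: nseq i x ++ 2 :: nseq c y ++ 2 :: nseq j x]] ->
  exists2 D', BS2_move P4 D D' & nimber (BS2_move P4) D' 0.
Proof.
case: D => g R /= regD xy ij c2 gE RE; rewrite {}gE in regD *.
suff [u [v [s [t [juv uvR ms mt]]]]] : exists u v s t,
    [/\ joinable (extend [::] 2 x y) u v,
        draw_curve [:: 3] u v R [:: [:: s]; [:: t]],
        moves_left (extend (extend [::] 2 x y) 3 u v) 2 s
      & moves_left (extend (extend [::] 2 x y) 3 u v) 2 t].
  eexists; first exact: (joinable_move regD uvR juv).
  (* Two regions with two moves each: 4 is even. *)
  apply: (@total_moves_left_nimber _ 4); first exact: regular_extend regD uvR juv.
  exists [:: (2, s); (2, t)]; split=> //=.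
    by move=> p; rewrite !inE => /orP[]/eqP->.
  by rewrite !big_cons big_nil.
case: c c2 RE => // c c2 RE.
case: i ij RE => [|i] ij RE.
- case: j ij RE => // j ij RE.
  (* Here the word starts with 2: the first tip of [y] is joined to the first tip of [x]. *)
  exists y, x, (3 :: nseq c y ++ [:: 2]), (2 :: 3 :: nseq j x); split.
  + by move: xy; rewrite !inE => /orP[]/eqP[-> ->].
  + apply: (DrawSplit (a := [:: 2]) (w := nseq c y ++ [:: 2]) (b := nseq j x)
      (A := [::]) (B := [::]) RE) => //=.
    by rewrite -catA.
  + by apply: TwoMovesEnds => //; move: xy; rewrite !inE => /orP[]/eqP[-> ->].
  + by apply: (TwoMoves (i := 0)) => //; move: xy; rewrite !inE => /orP[]/eqP[-> ->].
(* The last [x] before the first 2 is joined to the last [y], so each side sees 3 next to 2. *)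
- exists x, y, (3 :: 2 :: nseq c y), (nseq i x ++ 3 :: 2 :: nseq j x); split.
  + by move: xy; rewrite !inE => /orP[]/eqP[-> ->].
  + apply: (DrawSplit (a := nseq i x) (w := 2 :: nseq c y) (b := 2 :: nseq j x)
      (A := [::]) (B := [::]) RE); last exact: perm_refl.
    by rewrite -addn1 -[in nseq c.+1 y]addn1 !nseqD -!catA.
  + by apply: (TwoMoves (i := 0)) => //; move: xy; rewrite !inE => /orP[]/eqP[-> ->].
  + by apply: TwoMoves; try lia; move: xy; rewrite !inE => /orP[]/eqP[-> ->].
Qed.

Theorem theorem6p1 (p q : nat) (hp : 3 <= p) (hq : 3 <= q) :
  nimber (BS2_move P4) (BS2_start p q) 0.
Proof.
split=> // D startD.
have regD := regular_move (regular_start p q) startD.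
have w2 : all (fun r => 2 <= weight r) (regions (BS2_start p q)).
  by rewrite /= /weight !big_cons big_nil !size_nseq; lia.
have [k _ Dk] := nimber_exists (@excess_move P4) (proj1 (excess_move w2 startD)).
(* Were this nimber 0, no option could have nimber 0, against the winning reply. *)
exists k => // k0; rewrite {}k0 in Dk.
have [x [y [i [j [c [xy ij c2 gD RD]]]]]] := first_move hp hq startD.
have [D' DD' D'0] := winning_reply regD xy ij c2 gD RD.
case: Dk => opt _; have [l l0 D'l] := opt _ DD'.
by case: l0; apply: nimber_unique D'l D'0.
Qed.
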